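(* Let $A$ be an octonion division algebra over a field $F$, let $\phi(z)=c_n z^n+\dots+c_1 z+c_0$ be a standard polynomial over $A$ (with $c_0,\dots,c_n\in A$), and let $\Phi(z)$ be its companion polynomial. Then $R(\Phi)\supseteq R(\phi)$.
   Context: $F$ is a field of arbitrary characteristic. An octonion algebra over $F$ is an algebra $A=Q\oplus Q\ell$, where $Q$ is a quaternion algebra over $F$ with its canonical symplectic involution $\bar{\ }$, $\ell^2\in F^\times$, and multiplication is $(p+q\ell)(r+s\ell)=pr+\ell^2\bar{s}q+(sp+q\bar{r})\ell$. The involution extends to $A$ by $\overline{p+q\ell}=\overline{p}-q\ell$. The norm form $\operatorname{Norm}(x)=\overline{x}\cdot x$ and the trace form $\operatorname{Tr}(x)=x+\overline{x}$ take values in $F$. $A$ is alternative; it is a division algebra if and only if its norm form is anisotropic. A standard polynomial over $A$ is a polynomial $\phi(z)=c_n z^n+\dots+c_1z+c_0$ with coefficients $c_i\in A$ on the left of the variable; for $\lambda\in A$, $\phi(\lambda)=c_n\lambda^n+\dots+c_1\lambda+c_0$. $R(\phi)=\{\lambda\in A:\phi(\lambda)=0\}$ is the set of roots of $\phi$ in $A$. The companion polynomial of $\phi$ is $\Phi(z)=b_{2n}z^{2n}+\dots+b_1z+b_0$ where, for $k\in\{0,\dots,2n\}$: if $k$ is odd, $b_k$ is the sum of all $\operatorname{Tr}(\overline{c_i}c_j)$ with $0\le i<j\le n$ and $i+j=k$; if $k=2m$ is even, $b_k$ is the sum of all $\operatorname{Tr}(\overline{c_i}c_j)$ with $0\le i<j\le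 n$ and $i+j=k$, plus $\operatorname{Norm}(c_m)$. The coefficients $b_k$ lie in $F$, and $R(\Phi)$ denotes the set of roots of $\Phi$ in $A$. *)

(* Defs.v *)
From HB Require Import structures.
From mathcomp Require Import all_boot all_order all_algebra all_field.

Set Implicit Arguments.
Unset Strict Implicit.
Unset Printing Implicit Defensive.

Import GRing.Theory.
Local Open Scope ring_scope.

(* Central simple of dimension 4: this covers every characteristic and includes
   the split algebra.  A two-sided ideal of a unital algebra is a subspace, so
   ranging over {vspace Q} loses no ideal. *)
Definition quaternion_algebra (F : fieldType) (Q : falgType F) : Prop :=
  [/\ \dim {:Q} = 4%N,
      'Z({:Q})%VS = 1%VS
    & forall I : {vspace Q}, ({:Q} * I <= I)%VS -> (I * {:Q} <= I)%VS ->
        I = 0%VS \/ I = fullv].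

(* The F-linear involution with trace and norm in F = 1%VS; there is at most
   one, see canonical_involution_uniq. *)
Definition canonical_involution (F : fieldType) (Q : falgType F) (s : Q -> Q)
    : Prop :=
  [/\ linear s,
      forall p q, s (p * q) = s q * s p,
      involutive s
    & forall p, (p + s p \in 1%VS) && (s p * p \in 1%VS)].

Record octonionAlgebra (F : fieldType) := OctonionAlgebra {
  quat : falgType F;
  qconj : quat -> quat;
  lsq : F;  (* the square of the adjoined element l *)
  quatP : quaternion_algebra quat;
  qconjP : canonical_involution qconj;
  lsq_neq0 : lsq != 0
}.

(* The pair (p, q) stands for p + q l. *)
Definition octonion (F : fieldType) (A : octonionAlgebra F) : lmodType F :=
  (quat A * quat A)%type.
Coercion octonion : octonionAlgebra >-> GRing.Lmodule.type.

Section Octonions.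
Variables (F : fieldType) (A : octonionAlgebra F).
Implicit Types x y : A.

Definition oscalar (a : F) : A := (a%:A, 0).

Definition omul x y : A :=
  (x.1 * y.1 + lsq A *: (qconj y.2 * x.2), y.2 * x.1 + x.2 * qconj y.1).

Definition oconj x : A := (qconj x.1, - x.2).

(* Tr and Norm are kept as elements of A; they are scalars by otrace_scalar
   and onorm_scalar. *)
Definition otrace x : A := x + oconj x.
Definition onorm x : A := omul (oconj x) x.

(* Alternative algebras are power-associative, so the bracketing of x ^ k is
   immaterial. *)
Fixpoint oexp x (k : nat) : A :=
  if k is k'.+1 then omul (oexp x k') x else oscalar 1.

End Octonions.

(* A is finite-dimensional but not associative: division is understood as the
   unique solvability of a x = b and x a = b for a != 0. *)
Definition division_octonion (F : fieldType) (A : octonionAlgebra F) : Prop :=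
  forall a : A, a != 0 ->
    bijective (fun x : A => omul a x) /\ bijective (fun x : A => omul x a).

Section Polynomials.
Variables (F : fieldType) (A : octonionAlgebra F).

(* A standard polynomial c_n z^n + ... + c_0 is its family of left coefficients;
   c_n may be 0. *)
Definition opeval n (c : 'I_n.+1 -> A) (x : A) : A :=
  \sum_(i < n.+1) omul (c i) (oexp x i).

Definition oproots n (c : 'I_n.+1 -> A) : pred A :=
  [pred x | opeval c x == 0].

Definition companion n (c : 'I_n.+1 -> A) : 'I_(n.*2).+1 -> A := fun k =>
  let S := \sum_(i < n.+1) \sum_(j < n.+1 | (i < j)%N && (i + j == k)%N)
             otrace (omul (oconj (c i)) (c j)) in
  if odd k then S else S + onorm (c (inord k./2)).

End Polynomials.

Section Scalars.

Lemma canonical_involution_uniq (F : fieldType) (Q : falgType F) (s t : Q -> Q) :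
  canonical_involution s -> canonical_involution t -> s =1 t.
Proof.
move=> [sl sM sK sP] [tl tM tK tP] p.
have fix1 (u : Q -> Q) : linear u -> (forall p q, u (p * q) = u q * u p) ->
    involutive u -> forall a, u a%:A = a%:A.
  move=> ul uM uK a.
  have u0 : u 0 = 0 by have := ul (-1) 0 0; rewrite !scaleN1r !addNr.
  have u1 : u 1 = 1 by rewrite -[LHS]mulr1 -{2}(uK 1) -uM mulr1 uK.
  by have := ul a 1 0; rewrite !addr0 u0 u1 addr0.
have /andP[/vlineP[a sa] /vlineP[b sb]] := sP p.
have /andP[/vlineP[c tc] /vlineP[d td]] := tP p.
have Es : s p = a%:A - p by rewrite -sa addrC addKr.
have Et : t p = c%:A - p by rewrite -tc addrC addKr.
have [ac|ac] := eqVneq a c; first by rewrite Es Et ac.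
have acp : (a - c) *: p = (b - d)%:A.
  rewrite [RHS]scalerBl -sb -td Es Et -mulrBl opprB addrA subrK -scalerBl.
  by rewrite mulr_algl.
have pE : p = ((a - c)^-1 * (b - d))%:A.
  by rewrite -scalerA -acp scalerA mulVf ?subr_eq0 // scale1r.
by rewrite pE !fix1.
Qed.

Variables (F : fieldType) (A : octonionAlgebra F).

Lemma otrace_scalar (x : A) : exists a, otrace x = oscalar A a.
Proof.
have [_ _ _ /(_ x.1)/andP[/vlineP[a xa] _]] := qconjP A.
by exists a; rewrite /otrace /oconj /oscalar -xa; case: x {xa} => p q; congr pair; rewrite /= subrr.
Qed.

Lemma onorm_scalar (x : A) : exists a, onorm x = oscalar A a.
Proof.
have [_ _ sK sP] := qconjP A.
have /andP[_ /vlineP[a xa]] := sP x.1; have /andP[_ /vlineP[b xb]] := sP x.2.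
exists (a - lsq A * b); rewrite /onorm /omul /oconj /oscalar /= xa.
by rewrite mulrN xb scalerN scalerA scalerBl mulNr subrr.
Qed.

Lemma companion_scalar n (c : 'I_n.+1 -> A) k :
  exists b, companion c k = oscalar A b.
Proof.
have scD (x y : A) : (exists a, x = oscalar A a) -> (exists a, y = oscalar A a) ->
    exists a, x + y = oscalar A a.
  move=> [a ->] [b ->]; exists (a + b).
  by rewrite /oscalar scalerDl; congr pair; rewrite /= addr0.
have sc0 : exists a, (0 : A) = oscalar A a.
  by exists 0; rewrite /oscalar scale0r.
rewrite /companion; set S := (X in if _ then X else _).
have SP : exists a, S = oscalar A a.
  rewrite /S; elim/big_ind: _ => // i _.
  by elim/big_ind: _ => // j _; apply: otrace_scalar.
by case: ifP => // _; apply: scD => //; apply: onorm_scalar.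
Qed.

End Scalars.

(* Main.v *)
From HB Require Import structures.
Require Import Defs.
From mathcomp Require Import all_boot all_order all_algebra all_field.

Set Implicit Arguments.
Unset Strict Implicit.
Unset Printing Implicit Defensive.

Import GRing.Theory.
Local Open Scope ring_scope.

(** Write [N] for the norm and [T] for the trace.  Every octonion [x] satisfies
    [x^2 = T(x) x - N(x)], so there are scalars [a_i] and [d_i] with
    [x^(i+j) = a_i x^j + d_i x^(j+1)] for all [j] ([oexpD]).  Put
    [E = \sum_i a_i c_i] and [G = \sum_i d_i c_i].  Then [phi(x) = E + G x].

    The companion polynomial is the formal product of [conj phi] and [phi], so
    [Phi(x) = \sum_(i, j) (conj c_i * c_j) x^(i+j)] ([opeval_companion]), and
    this expands bilinearly into
    [N(E) + (conj E * G + conj G * E) x + N(G) x^2].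

    If [phi(x) = 0] then [E = - G x].  The alternative laws, in the form
    [conj y (y z) = N(y) z] and [(z (conj y)) y = N(y) z] ([oconj_mulKl],
    [oconj_mulKr]), turn the middle coefficient into [- N(G) T(x)], and the
    multiplicativity of the norm ([onormM]) gives [N(E) = N(G) N(x)].  Hence
    [Phi(x) = N(G) (x^2 - T(x) x + N(x)) = 0]. *)

(** * Canonical involutions *)

Section CanonicalInvolution.

Variables (F : fieldType) (Q : falgType F) (s : Q -> Q).
Hypothesis sP : canonical_involution s.

Lemma involD : {morph s : p q / p + q}.
Proof. by case: sP => sl _ _ _ p q; rewrite -[p]scale1r sl !scale1r. Qed.

Lemma invol0 : s 0 = 0.
Proof. by apply: (addrI (s 0)); rewrite -involD !addr0. Qed.

Lemma involZ a : {morph s : p / a *: p}.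
Proof.
case: sP => sl _ _ _ p.
by have := sl a p 0; rewrite !addr0 invol0 addr0.
Qed.

Lemma involN : {morph s : p / - p}.
Proof. by move=> p; rewrite -scaleN1r involZ scaleN1r. Qed.

Lemma involM p q : s (p * q) = s q * s p.
Proof. by case: sP. Qed.

Lemma involK : involutive s.
Proof. by case: sP. Qed.

Lemma involMC p : p * s p = s p * p.
Proof.
case: sP => _ _ _ /(_ p)/andP[/vlineP[a sa] _].
have -> : s p = a%:A - p by rewrite -sa addrC addKr.
by rewrite mulrBl mulrBr mulr_algl mulr_algr.
Qed.

Lemma invol_norm p : exists a, s p * p = a%:A.
Proof. by case: sP => _ _ _ /(_ p)/andP[_ /vlineP]. Qed.

End CanonicalInvolution.

(** * Octonions: bilinearity, conjugation and the norm *)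

Section Octonions.

Variables (F : fieldType) (A : octonionAlgebra F).
Implicit Types (x y z : A) (a : F).

Let sP := qconjP A.

Lemma omul_is_linear x : linear (omul x).
Proof.
move=> a [r u] [r' u']; rewrite /omul /=.
congr pair => /=.
  rewrite mulrDr (involD sP) (involZ sP) mulrDl -!scalerAl -!scalerAr.
  by rewrite !scalerDr !scalerA [lsq A * a]mulrC addrACA.
by rewrite mulrDl (involD sP) (involZ sP) mulrDr -scalerAl -scalerAr scalerDr addrACA.
Qed.

HB.instance Definition _ x :=
  GRing.isLinear.Build F A A *:%R (omul x) (omul_is_linear x).

(** Right multiplication, as a function of the left factor. *)
Definition omulr y x := omul x y.

Lemma omulr_is_linear y : linear (omulr y).
Proof.
move=> a [r u] [r' u']; rewrite /omulr /omul /=.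
congr pair => /=.
  rewrite mulrDl mulrDr -!scalerAl -!scalerAr.
  by rewrite !scalerDr !scalerA [lsq A * a]mulrC addrACA.
by rewrite mulrDl mulrDr -scalerAl -scalerAr scalerDr addrACA.
Qed.

HB.instance Definition _ y :=
  GRing.isLinear.Build F A A *:%R (omulr y) (omulr_is_linear y).

Lemma omulDr x y z : omul x (y + z) = omul x y + omul x z.
Proof. exact: linearD. Qed.

Lemma omul0r x : omul x 0 = 0.
Proof. exact: linear0. Qed.

Lemma omulNr x y : omul x (- y) = - omul x y.
Proof. exact: linearN. Qed.

Lemma omulZr a x y : omul x (a *: y) = a *: omul x y.
Proof. exact: linearZ. Qed.

Lemma omul_sumr (I : Type) (r : seq I) (P : pred I) (f : I -> A) x :
  omul x (\sum_(i <- r | P i) f i) = \sum_(i <- r | P i) omul x (f i).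
Proof. exact: linear_sum. Qed.

Lemma omulDl x y z : omul (y + z) x = omul y x + omul z x.
Proof. exact: (linearD (omulr x)). Qed.

Lemma omulNl x y : omul (- y) x = - omul y x.
Proof. exact: (linearN (omulr x)). Qed.

Lemma omulZl a x y : omul (a *: y) x = a *: omul y x.
Proof. exact: (linearZ_LR (omulr x)). Qed.

Lemma omul_suml (I : Type) (r : seq I) (P : pred I) (f : I -> A) x :
  omul (\sum_(i <- r | P i) f i) x = \sum_(i <- r | P i) omul (f i) x.
Proof. exact: (linear_sum (omulr x)). Qed.

Lemma oconj_is_linear : linear (@oconj F A).
Proof.
move=> a [r u] [r' u']; rewrite /oconj /=.
by congr pair => /=; rewrite ?(involD sP) ?(involZ sP) // opprD scalerN.
Qed.

HB.instance Definition _ :=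
  GRing.isLinear.Build F A A *:%R (@oconj F A) oconj_is_linear.

Lemma oconj0 : oconj (0 : A) = 0.
Proof. exact: linear0. Qed.

Lemma oconjN x : oconj (- x) = - oconj x.
Proof. exact: linearN. Qed.

Lemma oconjZ a x : oconj (a *: x) = a *: oconj x.
Proof. exact: linearZ. Qed.

Lemma oconj_sum (I : Type) (r : seq I) (P : pred I) (f : I -> A) :
  oconj (\sum_(i <- r | P i) f i) = \sum_(i <- r | P i) oconj (f i).
Proof. exact: linear_sum. Qed.

Lemma oconjK : involutive (@oconj F A).
Proof. by move=> [p q]; rewrite /oconj /= (involK sP) opprK. Qed.

Lemma oconjM x y : oconj (omul x y) = omul (oconj y) (oconj x).
Proof.
case: x y => [p q] [r u]; rewrite /oconj /omul /=; congr pair => /=.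
  by rewrite (involD sP) (involZ sP) !(involM sP) (involK sP) (involN sP) mulrNN.
by rewrite (involK sP) opprD addrC !mulNr.
Qed.

Lemma oscalarE a : oscalar A a = a *: oscalar A 1.
Proof. by rewrite /oscalar /=; congr pair; rewrite /= ?scaler0 // scale1r. Qed.

Lemma omul_scalarl a x : omul (oscalar A a) x = a *: x.
Proof.
case: x => p q; rewrite /oscalar /omul /=; congr pair => /=.
  by rewrite mulr_algl mulr0 scaler0 addr0.
by rewrite mulr_algr mul0r addr0.
Qed.

Lemma omulr1 x : omul x (oscalar A 1) = x.
Proof.
have s1 : qconj (1 : quat A) = 1.
  by rewrite -[LHS]mulr1 -{2}(involK sP 1) -(involM sP) mulr1 (involK sP).
case: x => p q; rewrite /oscalar /omul /= scale1r s1; congr pair => /=.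
  by rewrite mulr1 (invol0 sP) mul0r scaler0 addr0.
by rewrite mul0r mulr1 add0r.
Qed.

Lemma omul1r x : omul (oscalar A 1) x = x.
Proof. by rewrite omul_scalarl scale1r. Qed.

Lemma onorm_conj x : onorm (oconj x) = onorm x.
Proof.
case: x => p q; rewrite /onorm /omul /oconj /=; congr pair => /=.
  by rewrite (involK sP) (involMC sP) (involN sP) mulNr mulrN opprK.
by rewrite !mulNr !subrr.
Qed.

(** In components, the terms mixing [x.1] and [x.2] cancel; the others only
    involve the scalars [qconj x.1 * x.1] and [qconj x.2 * x.2]. *)
Lemma oconj_mulKl x y : omul (oconj x) (omul x y) = omul (onorm x) y.
Proof.
have [a Na] := invol_norm sP x.1; have [b Nb] := invol_norm sP x.2.
have -> : onorm x = oscalar A (a - lsq A * b).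
  rewrite /onorm /omul /oconj /oscalar /= Na; congr pair => /=.
    by rewrite mulrN Nb scalerN scalerA scalerBl.
  by rewrite mulNr subrr.
rewrite omul_scalarl.
case: x y Na Nb => [p q] [r u] /= Na Nb; rewrite /omul /oconj /=.
congr pair => /=.
  rewrite mulrDr mulrA Na mulr_algl mulrN scalerN (involD sP) !(involM sP).
  rewrite (involK sP) mulrDl -!mulrA Nb mulr_algr -scalerAr scalerDr opprD.
  by rewrite addrA addrK scalerA scalerBl.
rewrite mulrDl (involD sP) (involZ sP) !(involM sP) (involK sP) -!mulrA.
rewrite (involMC sP) Na mulr_algr mulNr mulrDr opprD addrA addrK.
by rewrite -scalerAr mulrA (involMC sP) Nb mulr_algl scalerA scalerBl.
Qed.

(** Conjugating [oconj_mulKl] gives its mirror image. *)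
Lemma oconj_mulKr x y : omul (omul y (oconj x)) x = omul (onorm x) y.
Proof.
have [a Na] := onorm_scalar x; apply: (can_inj (@oconjK)).
rewrite [in RHS]Na omul_scalarl oconjZ !oconjM oconjK oconj_mulKl.
by rewrite Na omul_scalarl.
Qed.

(** Both norms are scalars, so for [y != 0] it is enough to compare their
    products with [oconj y]. *)
Lemma onormM x y : onorm (omul x y) = omul (onorm x) (onorm y).
Proof.
have [->|y0] := eqVneq y 0.
  by rewrite /onorm !omul0r.
have [a Na] := onorm_scalar x; have [b Nb] := onorm_scalar y.
have [e Ne] := onorm_scalar (omul x y).
have cy0 : oconj y != 0.
  by apply: contraNneq y0 => cy; rewrite -[y]oconjK cy oconj0.
suff ->: onorm (omul x y) = oscalar A (a * b).
  by rewrite Na Nb omul_scalarl [in RHS]oscalarE scalerA -oscalarE.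
(* By [oconj_mulKl], [N(xy) conj y = conj (xy) ((xy) (conj y))], where
   [(xy) (conj y) = N(y) x]. *)
suff /eqP: e *: oconj y = (a * b) *: oconj y.
  by rewrite -subr_eq0 -scalerBl scaler_eq0 (negPf cy0) orbF subr_eq0 => /eqP <-.
have xyK : omul (omul x y) (oconj y) = b *: x.
  by rewrite -{1}[y]oconjK oconj_mulKr onorm_conj Nb omul_scalarl.
rewrite -omul_scalarl -Ne -oconj_mulKl xyK omulZr oconjM oconj_mulKr Na.
by rewrite omul_scalarl scalerA mulrC.
Qed.

Lemma otraceM_conj x y :
  otrace (omul (oconj x) y) = omul (oconj x) y + omul (oconj y) x.
Proof. by rewrite /otrace oconjM oconjK. Qed.

(** * Powers of an octonion *)

Lemma osqr x : omul x x = omul (otrace x) x - onorm x.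
Proof. by rewrite omulDl addrK. Qed.

Lemma oexp_rec x : exists t m : F,
  forall j, oexp x j.+2 = t *: oexp x j.+1 - m *: oexp x j.
Proof.
have [t Tt] := otrace_scalar x; have [m Nm] := onorm_scalar x.
exists t, m; elim=> [|j IHj].
  by rewrite /= omul1r osqr Tt Nm omul_scalarl -oscalarE.
by rewrite -[LHS]/(omul (oexp x j.+2) x) [in LHS]IHj omulDl omulNl !omulZl.
Qed.

(** For [j = 0] this writes [x ^ i] as a combination of [1] and [x]; the same
    scalars serve for every [j]. *)
Lemma oexpD x : exists a d : nat -> F,
  forall i j, oexp x (i + j) = a i *: oexp x j + d i *: oexp x j.+1.
Proof.
have [t [m rec]] := oexp_rec x.
pose f i := iter i (fun u : F * F => (- (m * u.2), u.1 + t * u.2)) (1, 0).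
exists (fun i => (f i).1), (fun i => (f i).2); elim=> [|i IHi] j.
  by rewrite scale1r scale0r addr0.
rewrite addSnnS IHi rec [f i.+1]iterS -/(f i) /=; case: (f i) => a d /=.
by rewrite scalerBr !scalerA scaleNr scalerDl (mulrC d m) (mulrC d t) addrA addrC.
Qed.

End Octonions.

(** * The companion polynomial *)

Section Companion.

Variables (F : fieldType) (A : octonionAlgebra F) (n : nat).
Variable c : 'I_n.+1 -> A.

(** The companion polynomial is the formal product of the conjugate polynomial
    and the polynomial itself: the pairs [(i, j)] and [(j, i)] with [i < j]
    together contribute a trace, and the diagonal contributes a norm. *)
Lemma companionE (k : 'I_(n.*2).+1) :
  companion c k =
  \sum_(i < n.+1) \sum_(j < n.+1 | (i + j == k)%N) omul (oconj (c i)) (c j).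
Proof.
rewrite /companion /=; pose G i j := omul (oconj (c i)) (c j).
pose L (i j : 'I_n.+1) := (i < j)%N && (i + j == k)%N.
have -> : \sum_(i < n.+1) \sum_(j < n.+1 | (i + j == k)%N) G i j
    = \sum_(i < n.+1) \sum_(j < n.+1 | L i j) G i j
      + \sum_(i < n.+1) \sum_(j < n.+1 | L j i) G i j
      + \sum_(i < n.+1 | (i + i == k)%N) G i i.
  rewrite [X in _ + X]big_mkcond -!big_split; apply: eq_bigr => i _ /=.
  rewrite (bigID (fun j : 'I_n.+1 => (i < j)%N)) -addrA; congr (_ + _).
    by apply: eq_bigl => j; rewrite andbC.
  rewrite (bigID (fun j : 'I_n.+1 => (j < i)%N)); congr (_ + _).
    apply: eq_bigl => j; rewrite /L addnC -leqNgt.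
    by case: ltngtP; rewrite ?andbF ?andbT.
  rewrite (eq_bigl (fun j => (j == i) && (i + i == k)%N)) => [|j].
    by rewrite big_mkcondr big_pred1_eq.
  rewrite -!leqNgt -andbA -eqn_leq andbC eq_sym -val_eqE.
  by case: eqVneq => // ->.
have -> : \sum_(i < n.+1) \sum_(j < n.+1 | L i j) otrace (G i j)
    = \sum_(i < n.+1) \sum_(j < n.+1 | L i j) G i j
      + \sum_(i < n.+1) \sum_(j < n.+1 | L j i) G i j.
  rewrite [X in _ + X](exchange_big_dep xpredT) //= -big_split /=.
  apply: eq_bigr => i _; rewrite -big_split /=.
  by apply: eq_bigr => j _; rewrite otraceM_conj.
case: ifP => [k_odd|/negbT k_even].
  rewrite [X in _ = _ + X]big_pred0 ?addr0 // => i.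
  apply: contraTF k_odd => /eqP <-.
  by rewrite addnn odd_double.
have k2 : (k./2 < n.+1)%N by rewrite ltnS -[leqRHS]doubleK half_leq // -ltnS.
rewrite [X in _ = _ + X](big_pred1 (inord k./2)) // => i.
rewrite /= -val_eqE /= inordK // addnn.
by rewrite -{1}[val k](even_halfK k_even) (inj_eq double_inj).
Qed.

Lemma opeval_companion x :
  opeval (companion c) x =
  \sum_(i < n.+1) \sum_(j < n.+1)
    omul (omul (oconj (c i)) (c j)) (oexp x (i + j)).
Proof.
rewrite /opeval; under eq_bigr => k _ do rewrite companionE omul_suml.
rewrite exchange_big; apply: eq_bigr => i _ /=.
under eq_bigr => k _ do rewrite omul_suml.
rewrite (exchange_big_dep xpredT) //=; apply: eq_bigr => j _.
have ltij : (i + j < (n.*2).+1)%N by rewrite ltnS -addnn leq_add // -ltnS.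
by rewrite (big_pred1 (Ordinal ltij)) // => k; rewrite eq_sym.
Qed.

End Companion.

Theorem theorem3p3 (F : fieldType) (A : octonionAlgebra F)
  (hA : division_octonion A) (n : nat) (c : 'I_n.+1 -> A) :
  {subset oproots c <= oproots (companion c)}.
Proof.
move=> x; rewrite !inE => /eqP phi0; apply/eqP.
have [a [d expD]] := oexpD x.
have exp1 i : oexp x i = a i *: oscalar A 1 + d i *: x.
  by rewrite -[i in LHS]addn0 expD /= omul1r.
pose E := \sum_(i < n.+1) a i *: c i; pose G := \sum_(i < n.+1) d i *: c i.
have EG : E = - omul G x.
  apply/eqP; rewrite -addr_eq0 -phi0 omul_suml -big_split /=.
  apply/eqP; apply: eq_bigr => i _.
  by rewrite exp1 omulDr !omulZr omulr1 omulZl.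
(* Since [x ^ (i + j) = (a i + d i x) (a j + d j x)], the double sum splits
   into four sums, one for each pair of factors among [E] and [G]. *)
have PhiE : opeval (companion c) x = onorm E
    + omul (omul (oconj E) G + omul (oconj G) E) x + omul (onorm G) (omul x x).
  have bil (u v : 'I_n.+1 -> F) w :
      \sum_(i < n.+1) \sum_(j < n.+1)
        (u i * v j) *: omul (omul (oconj (c i)) (c j)) w
      = omul (omul (oconj (\sum_i u i *: c i)) (\sum_j v j *: c j)) w.
    rewrite oconj_sum !omul_suml; apply: eq_bigr => i _.
    rewrite omul_sumr omul_suml; apply: eq_bigr => j _.
    by rewrite oconjZ omulZr !omulZl scalerA mulrC.
  rewrite -[onorm E]omulr1 omulDl -!bil -!big_split opeval_companion.
  apply: eq_bigr => i _ /=; rewrite -!big_split; apply: eq_bigr => j _ /=.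
  rewrite expD [oexp x j.+1]/= !exp1 !(omulDl, omulZl) omul1r.
  by rewrite !(omulDr, omulZr) !scalerDr !scalerA !addrA.
have [g Ng] := onorm_scalar G.
have mid : omul (oconj E) G + omul (oconj G) E = - (g *: otrace x).
  rewrite EG oconjN omulNl omulNr oconjM oconj_mulKr oconj_mulKl Ng.
  by rewrite !omul_scalarl -opprD -scalerDr addrC.
have NE : onorm E = g *: onorm x.
  rewrite EG /onorm oconjN omulNl omulNr opprK -/(onorm _) onormM Ng.
  by rewrite omul_scalarl.
rewrite PhiE mid NE Ng omul_scalarl osqr omulNl omulZl scalerBr.
by rewrite addrC addrA subrK subrr.
Qed.
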